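(* Let $H\in M_N(\mathbb C)$ and $K\in M_M(\mathbb C)$ be complex Hadamard matrices, $B\in T^\circ_HC_N$ and $C\in T^\circ_KC_M$. Then: (1) for any $\lambda\in\mathbb R$, $\psi\in\mathbb R^N$, and real numbers $X_{ia},Y_{jb},F_{aj}$ ($i,j\in\{1,\ldots,N\}$, $a,b\in\{1,\ldots,M\}$), the matrix $A_{ia,jb}=\lambda B_{ij}+\psi_jC_{ab}+X_{ia}+Y_{jb}+F_{aj}$ belongs to $T^\circ_{H\otimes K}C_{NM}$; (2) for any $\mu\in\mathbb R$, $\phi\in\mathbb R^M$, and real numbers $X_{ia},Y_{jb},E_{ib}$, the matrix $A_{ia,jb}=\phi_bB_{ij}+\mu C_{ab}+X_{ia}+Y_{jb}+E_{ib}$ belongs to $T^\circ_{H\otimes K}C_{NM}$.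
   Context: A complex Hadamard matrix is a square complex matrix with all entries of modulus $1$ and pairwise orthogonal rows; $(H\otimes K)_{ia,jb}=H_{ij}K_{ab}$. For a complex Hadamard matrix $H\in M_N(\mathbb C)$, the affine tangent cone $T^\circ_HC_N$ is the set of $A\in M_N(\mathbb R)$ such that $(H_{ij}e^{itA_{ij}})_{ij}$ is a complex Hadamard matrix for all real $t$ in some neighborhood of $0$. *)

(* Defs.v *)
From mathcomp Require Import all_boot all_order all_algebra.
From mathcomp Require Import complex mxtens.
From mathcomp Require Import boolp classical_sets reals topology normedtype trigo.

Set Implicit Arguments.
Unset Strict Implicit.
Unset Printing Implicit Defensive.

Import Order.TTheory GRing.Theory Num.Theory.
Import numFieldNormedType.Exports.

Local Open Scope ring_scope.
Local Open Scope classical_set_scope.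

(* The norm of R[i] takes values in R[i]. *)
Definition complex_hadamard (R : realType) (n : nat) (H : 'M[R[i]]_n) : Prop :=
  (forall i j, `|H i j| = 1) /\
  (forall i k, i != k -> \sum_j H i j * (H k j)^* = 0).

(* e^{ix} for real x, by Euler's formula *)
Definition expi (R : realType) (x : R) : R[i] := Complex (cos x) (sin x).

Definition phase_deform (R : realType) (n : nat)
    (H : 'M[R[i]]_n) (A : 'M[R]_n) (t : R) : 'M[R[i]]_n :=
  \matrix_(i, j) (H i j * expi (t * A i j)).

(* Meant for a complex Hadamard matrix H. *)
Definition affine_tangent_cone (R : realType) (n : nat) (H : 'M[R[i]]_n) :
    set 'M[R]_n :=
  [set A | \forall t \near (0 : R), complex_hadamard (phase_deform H A t)].

(* The matrix with entry f i a j b in row (i, a) and column (j, b), for the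
   same indexing of pairs as in the library's Kronecker product [tensmx]. *)
Definition mx_of_pairs (R : Type) (n m : nat)
    (f : 'I_n -> 'I_m -> 'I_n -> 'I_m -> R) : 'M[R]_(n * m) :=
  \matrix_(p, q) f (mxtens_unindex p).1 (mxtens_unindex p).2
                   (mxtens_unindex q).1 (mxtens_unindex q).2.

(* Main.v *)
(* For each fixed j, the K-factor deformed at speed psi_j still has orthogonal
   rows, so the sum over b of an inner product of rows (i, a) and (k, c)
   vanishes when a <> c.  When a = c that inner sum does not depend on j, F
   cancels, and orthogonality of the rows i <> k of the deformation of H
   concludes.  The second half is the first one with the roles of H and K
   exchanged. *)
Require Import Defs.
From mathcomp Require Import all_boot all_order all_algebra.
From mathcomp Require Import complex mxtens.
From mathcomp Require Import boolp classical_sets reals topology normedtype trigo.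
From mathcomp Require Import ring.

Set Implicit Arguments.
Unset Strict Implicit.
Unset Printing Implicit Defensive.

Import Order.TTheory GRing.Theory Num.Theory.
Import numFieldNormedType.Exports.

Local Open Scope ring_scope.

Lemma normr_expi (R : realType) (x : R) : `|expi x| = 1.
Proof. by rewrite /expi normc_def /= cos2Dsin2 sqrtr1. Qed.

Lemma expiD (R : realType) (x y : R) : expi (x + y) = expi x * expi y.
Proof.
by rewrite /expi cosD sinD; apply/eqP; rewrite eq_complex /= eqxx /= addrC.
Qed.

Lemma norm1_conjK (C : numClosedFieldType) (z : C) : `|z| = 1 -> z * z^* = 1.
Proof. by move=> z1; rewrite -normCK z1 expr1n. Qed.

(** Keeping the indices as pairs lets the two tensor factors be exchanged without permuting the rows
    and columns of a matrix. *)
Definition pair_hadamard (R : realType) (n m : nat)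
    (f : 'I_n -> 'I_m -> 'I_n -> 'I_m -> R[i]) : Prop :=
  (forall i a j b, `|f i a j b| = 1) /\
  (forall i a k c, (i, a) != (k, c) ->
    \sum_j \sum_b f i a j b * (f k c j b)^* = 0).

Lemma pair_hadamard_mx (R : realType) (n m : nat)
    (f : 'I_n -> 'I_m -> 'I_n -> 'I_m -> R[i]) :
  pair_hadamard f -> complex_hadamard (mx_of_pairs f).
Proof.
move=> [f1 f0]; split=> [p q|p q pq]; first by rewrite mxE.
under eq_bigr do rewrite !mxE.
have unindex_bij : bijective (@mxtens_unindex n m).
  by exists (@mxtens_index n m); [exact: mxtens_unindexK | exact: mxtens_indexK].
rewrite -[RHS](f0 (mxtens_unindex p).1 (mxtens_unindex p).2
                  (mxtens_unindex q).1 (mxtens_unindex q).2); last first.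
  by rewrite -!surjective_pairing (inj_eq (bij_inj unindex_bij)).
rewrite pair_big /=.
by rewrite [RHS](reindex (@mxtens_unindex n m)) //; exact: onW_bij.
Qed.

Lemma pair_hadamard_swap (R : realType) (n m : nat)
    (f : 'I_n -> 'I_m -> 'I_n -> 'I_m -> R[i]) :
  pair_hadamard f -> pair_hadamard (fun a i b j => f i a j b).
Proof.
move=> [f1 f0]; split=> [//|a i c k ac].
by rewrite exchange_big f0 //; move: ac; rewrite !xpair_eqE andbC.
Qed.

(** This is Dita's generalised tensor product with extra phases: [x] and [y] only rescale rows and
    columns, and [f a j] can be absorbed into row [a] of [V j], which stays Hadamard. *)
Lemma pair_hadamard_dita (R : realType) (n m : nat)
    (U : 'M[R[i]]_n) (V : 'I_n -> 'M[R[i]]_m)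
    (x y : 'I_n -> 'I_m -> R[i]) (f : 'I_m -> 'I_n -> R[i]) :
  complex_hadamard U -> (forall j, complex_hadamard (V j)) ->
  (forall i a, `|x i a| = 1) -> (forall j b, `|y j b| = 1) ->
  (forall a j, `|f a j| = 1) ->
  pair_hadamard (fun i a j b => U i j * V j a b * (x i a * y j b * f a j)).
Proof.
move=> [U1 U0] hV x1 y1 f1; split=> [i a j b|i a k c ne].
  by rewrite !normrM U1 (hV j).1 x1 y1 f1 !mulr1.
have inner j :
    \sum_b U i j * V j a b * (x i a * y j b * f a j) *
           (U k j * V j c b * (x k c * y j b * f c j))^* =
    x i a * (x k c)^* * (f a j * (f c j)^*) * (U i j * (U k j)^*) *
    \sum_b V j a b * (V j c b)^*.
  rewrite mulr_sumr; apply: eq_bigr => b _; rewrite !rmorphM /=.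
  (* Both rows carry the same column phase [y j b], so it meets its own conjugate; the right side
     gets this product in place of a factor 1. *)
  by rewrite -[RHS]mulr1 -(norm1_conjK (y1 j b)); ring.
under eq_bigr do rewrite inner.
have [ac|ac] := eqVneq a c; last first.
  by apply: big1 => j _; rewrite (hV j).2 // mulr0.
rewrite -{}ac xpair_eqE eqxx andbT in ne *.
(* The factor [m] is the sum over [b] of the squared moduli of [V j a b]. *)
transitivity (x i a * (x k a)^* * m%:R * \sum_j U i j * (U k j)^*).
  rewrite mulr_sumr; apply: eq_bigr => j _.
  rewrite norm1_conjK //.
  under eq_bigr do rewrite (norm1_conjK ((hV j).1 _ _)).
  by rewrite sumr_const card_ord; ring.
by rewrite U0 // mulr0.
Qed.

(** Holds because [t * r] tends to 0 with [t], including when [r] is 0. *)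
Lemma near_cone_scale (R : realType) (n : nat) (H : 'M[R[i]]_n) (A : 'M[R]_n)
    (r : R) :
  affine_tangent_cone H A ->
  \forall t \near (0 : R), complex_hadamard (phase_deform H A (t * r)).
Proof. by move=> hA; exact: (near0Z (r : R^o) hA). Qed.

(** The exponential splits: [lambda] changes the speed along [B], [psi j] the speed along [C] for
    each [j], and the other summands give the free phases of [pair_hadamard_dita]. *)
Lemma near_pair_hadamard (R : realType) (n m : nat)
    (H : 'M[R[i]]_n) (K : 'M[R[i]]_m) (B : 'M[R]_n) (C : 'M[R]_m)
    (lambda : R) (psi : 'I_n -> R) (x y : 'I_n -> 'I_m -> R)
    (f : 'I_m -> 'I_n -> R) :
  affine_tangent_cone H B -> affine_tangent_cone K C ->
  \forall t \near (0 : R), pair_hadamard (fun i a j b => H i j * K a b *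
    expi (t * (lambda * B i j + psi j * C a b + x i a + y j b + f a j))).
Proof.
move=> /(near_cone_scale lambda) hB hC.
have hCpsi : \forall t \near (0 : R),
    forall j, complex_hadamard (phase_deform K C (t * psi j)).
  (* There are finitely many [j], so one neighbourhood of 0 serves them all. *)
  apply: (@filter_forall _ _ _ (nbhs (0 : R))) => j.
  exact: near_cone_scale.
apply: filterS2 hB hCpsi => t hBt hCt.
have := pair_hadamard_dita hBt hCt (fun i a => normr_expi (t * x i a))
  (fun j b => normr_expi (t * y j b)) (fun a j => normr_expi (t * f a j)).
congr pair_hadamard; do 4 apply/funext => ?.
by rewrite !mxE !mulrDr !expiD !mulrA; ring.
Qed.

Lemma phase_deform_tensmx (R : realType) (n m : nat)
    (H : 'M[R[i]]_n) (K : 'M[R[i]]_m)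
    (A : 'I_n -> 'I_m -> 'I_n -> 'I_m -> R) (t : R) :
  phase_deform (tensmx H K) (mx_of_pairs A) t =
  mx_of_pairs (fun i a j b => H i j * K a b * expi (t * A i a j b)).
Proof. by apply/matrixP => p q; rewrite !mxE. Qed.

Theorem theorem2p7 (R : realType) (N M : nat)
    (H : 'M[R[i]]_N) (K : 'M[R[i]]_M)
    (hH : complex_hadamard H) (hK : complex_hadamard K)
    (B : 'M[R]_N) (C : 'M[R]_M)
    (hB : affine_tangent_cone H B) (hC : affine_tangent_cone K C) :
  (forall (lambda : R) (psi : 'rV[R]_N)
      (X Y : 'M[R]_(N, M)) (F : 'M[R]_(M, N)),
    affine_tangent_cone (tensmx H K)
      (mx_of_pairs (fun i a j b =>
        lambda * B i j + psi 0 j * C a b + X i a + Y j b + F a j))) /\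
  (forall (mu : R) (phi : 'rV[R]_M) (X Y E : 'M[R]_(N, M)),
    affine_tangent_cone (tensmx H K)
      (mx_of_pairs (fun i a j b =>
        phi 0 b * B i j + mu * C a b + X i a + Y j b + E i b))).
Proof.
split=> [lambda psi X Y F|mu phi X Y E].
  have := near_pair_hadamard lambda (psi 0) X Y F hB hC.
  apply: filterS => t ht.
  by rewrite phase_deform_tensmx; exact: pair_hadamard_mx.
(* With the factors exchanged, [X] and [Y] must be transposed, while [E i b] already has the index
   order expected of [f]. *)
have := near_pair_hadamard mu (phi 0) X^T Y^T E hC hB.
apply: filterS => t /pair_hadamard_swap ht.
rewrite phase_deform_tensmx; apply: pair_hadamard_mx.
move: ht; congr pair_hadamard; do 4 apply/funext => ?.
by rewrite !mxE; congr (_ * expi (_ * _)); ring.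
Qed.
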